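(* Let $T$ be a complete binary tree on $2^n-1$ vertices, let $\lambda$ be a $2$-periodic 1-labeling of $T$, and let $\mathcal{T}=(T,\lambda)$. Then $2^{n-3}\le M_2(\mathcal{T})\le 2^{n-2}$. Both bounds are tight.
   Context: The complete binary tree on $2^n-1$ vertices is the rooted binary tree in which every non-leaf vertex has exactly two children and all $2^{n-1}$ leaves are at distance $n-1$ from the root. For a positive integer $p$, a $p$-periodic 1-labeling $\lambda$ of a finite simple undirected graph $G=(V,E)$ assigns to each edge $e$ an infinite set of time-steps of the form $\{i,i+p,i+2p,\dots\}$ with $i\in\{1,\dots,p\}$ (so each edge is present exactly once in every $p$ consecutive time-steps). In the temporal graph $\mathcal{G}=(G,\lambda)$, a journey from $u$ to $v$ is a path in $G$ from $u$ to $v$ together with a choice, for each edge of the path, of a time-step in its label set so that the chosen time-steps are strictly increasing along the path. The temporal distance $\mathrm{dist}_t(u,v)$ is the smallest time-step at which a journey from $u$ reaches $v$ (with $\mathrm{dist}_t(u,u)=0$, and $\infty$ if there is no journey). A set $R\subseteq V$ is a temporal resolving set if (i) for every $v\in V$ there is a journey from some $s\in R$ to $v$ (every vertex is reached from itself), and (ii) for every two distinct $u,v\in V$ there is $s\in R$ with $\mathrm{dist}_t(s,u)\neq\mathrm{dist}_t(s,v)$. $M_p(\mathcal{G})$ denotes the minimum size of a temporal resolving set of $\mathcal{G}$ when $\lambda$ is a $p$-periodic 1-labeling.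
   Formalization: Stated for n ≥ 2, since for n = 1 the single-vertex tree has M_2 = 1 > 2^{-1}, so the upper bound fails; tightness is proved for every n ≥ 2 (upper bound) and every n ≥ 3 (lower bound, which is 1/2 and so unattainable at n = 2). *)

(* Defs.v *)
(* MathComp, with the classical layer of MathComp-Analysis for [asbool]. *)
From mathcomp Require Import all_boot all_order all_algebra.
From mathcomp Require Import boolp.

Set Implicit Arguments.
Unset Strict Implicit.
Unset Printing Implicit Defensive.

Record sgraph := SGraph {
  svertex :> finType;
  adj : rel svertex;
  adj_sym : symmetric adj;
  adj_irr : irreflexive adj
}.

Section Graphs.
Variable G : sgraph.
Implicit Types (r u v : G) (p : seq G).

(* A spath is a path in the graph-theoretic sense: no vertex is repeated. *)
Definition spath u v p : bool :=
  [&& path (@adj G) u p, last u p == v & uniq (u :: p)].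

Definition path_edges u p : seq {set G} :=
  pairmap (fun x y => [set x; y]) u p.

(* In a connected graph this is the length of a shortest path; it is #|G|
   when u and v are not connected. *)
Definition gdist u v : nat :=
  find (fun k => [exists p : k.-tuple G, spath u v p]) (iota 0 #|G|).

Definition is_tree : Prop :=
  (forall u v, connect (@adj G) u v) /\
  (forall c : seq G, 2 < size c -> ~~ ucycleb (@adj G) c).

Definition children r u : {set G} :=
  [set v | adj u v & gdist r v == (gdist r u).+1].

Definition leaves r : {set G} := [set v | children r v == set0].

Definition complete_binary_tree (n : nat) : Prop :=
  #|G| = 2 ^ n - 1 /\ is_tree /\
  exists r : G,
    [/\ forall v, v \notin leaves r -> #|children r v| = 2,
        #|leaves r| = 2 ^ n.-1
      & forall v, v \in leaves r -> gdist r v = n.-1].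

(* The set of time-steps of each edge; only the values at the edges
   [set u; v] with adj u v are relevant. *)
Definition labeling := {set G} -> nat -> Prop.

Definition periodic1_labeling (p : nat) (lam : labeling) : Prop :=
  forall u v, adj u v ->
    exists i, 1 <= i <= p /\
      (forall t, lam [set u; v] t <-> exists k, t = i + k * p).

Variable lam : labeling.

Definition is_journey u v p (ts : seq nat) : Prop :=
  [/\ spath u v p, size ts = size p, sorted ltn ts
    & forall i, i < size p -> lam (nth set0 (path_edges u p) i) (nth 0 ts i)].

(* The journey along the empty path arrives at time 0. *)
Definition reaches_at u v (t : nat) : Prop :=
  exists p ts, is_journey u v p ts /\ last 0 ts = t.

(* None stands for infinity. *)
Definition dist_t u v : option nat :=
  match pselect (exists t, `[< reaches_at u v t >]) with
  | left h => Some (ex_minn h)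
  | right _ => None
  end.

Definition temporal_resolving (R : {set G}) : Prop :=
  (forall v, exists s p ts, s \in R /\ is_journey s v p ts) /\
  (forall u v, u <> v -> exists2 s, s \in R & dist_t s u <> dist_t s v).

(* The default candidate [set: G] is resolving whenever all time-steps are
   positive, in particular for periodic 1-labelings. *)
Definition temporal_dim : nat :=
  #|[arg min_(R < [set: G] | `[< temporal_resolving R >]) #|R|]|.

End Graphs.

(* Main.v *)
(* In a tree the temporal distance from s propagates edge by edge along the unique path: crossing
   an edge costs 2 when its parity equals that of the current time and 1 otherwise.

   Upper bound: one leaf below each vertex of depth n - 2 suffices, because a vertex v lying on the
   path from s to v' has tdist s v < tdist s v', and two unselected leaves are separated by the
   selected sibling of one of them.

   Lower bound: a 7-vertex subtree rooted at x of depth n - 3 must meet R.  Otherwise all of R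
   enters it through one edge, the children of x are reached with delays 1 and 2, and some
   grandchild of x also with delay 2.

   Equality 2^(n-2) holds for constant labels, where sibling leaves are twins.  Equality 2^(n-3)
   holds when the two edges below each vertex have different parities: the leftmost leaf of a
   7-vertex bottom subtree then reaches its vertices at the times 0, ..., 6, and any other bottom
   subtree too late to interfere. *)
Require Import Defs.
From mathcomp Require Import all_boot all_order all_algebra.
From mathcomp Require Import boolp zify.

Set Implicit Arguments.
Unset Strict Implicit.
Unset Printing Implicit Defensive.

(** * Simple paths: uniqueness in acyclic graphs, and distances *)

Section SimplePaths.
Variable G : sgraph.
Implicit Types (u v w : G) (p q : seq G).

Lemma connect_spath u v : connect (@adj G) u v -> exists p, spath u v p.
Proof.
case/connectP=> p pth ->; case/shortenP: pth => q qp qu _.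
by exists q; rewrite /spath qp qu eqxx.
Qed.

Lemma spath_nil u p : spath u u p -> p = [::].
Proof.
case: p => // x p /and3P[_ /eqP lp /= /andP[]].
by rewrite -{1}lp /= mem_last.
Qed.

Lemma spath_unique :
  (forall c : seq G, 2 < size c -> ~~ ucycleb (@adj G) c) ->
  forall u v p q, spath u v p -> spath u v q -> p = q.
Proof.
move=> acyc u v p; elim: p u => [|x p IH] u q.
  by move=> /and3P[_ /eqP /= -> _] /spath_nil->.
case: q => [|y q]; first by move=> + /and3P[_ /eqP /= uv _]; rewrite uv => /spath_nil.
move=> pP qP; have [xy|xNy] := eqVneq x y.
  subst y; congr (_ :: _); apply: (IH x); rewrite /spath.
    by case/and3P: pP => /= /andP[_ ->] -> /andP[_ ->].
  by case/and3P: qP => /= /andP[_ ->] -> /andP[_ ->].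
case/and3P: pP => pp /eqP pl pu; case/and3P: qP => qp /eqP ql qu.
(* The paths part at [u]. Let [z] be the first vertex of [x :: p] that also lies on [y :: q]: going
   from [u] to [z] along [p] and back along [q] closes a cycle. *)
have hq : has (mem (y :: q)) (x :: p).
  apply/hasP; exists v; first by rewrite -pl /= mem_last.
    by rewrite -ql /= mem_last.
have [z [p1 [p2 [pE zq p1q]]]] : exists z p1 p2,
    [/\ x :: p = rcons p1 z ++ p2, z \in y :: q & ~~ has (mem (y :: q)) p1].
  by case: (split_find hq) => z p1 p2 zq p1q; exists z, p1, p2.
have [q1 [q2 qE]] : exists q1 q2, y :: q = rcons q1 z ++ q2.
  by case: (path.splitP zq) => q1 q2; exists q1, q2.
rewrite pE in pp pu; rewrite qE in qp qu p1q.
(* If [p1] and [q1] were both empty, then [x = z = y]. *)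
have sz : 2 < size (u :: rcons p1 z ++ rev q1).
  rewrite /= size_cat size_rcons size_rev addSn !ltnS.
  case: p1 q1 {pp pu qp qu p1q} pE qE => [|? ?] [|? ?] //= [xz _] [yz _].
  by rewrite xz yz eqxx in xNy.
case/negP: (acyc _ sz).
rewrite cat_path in pp; case/andP: pp => pp _.
rewrite cat_path in qp; case/andP: qp => qp _.
rewrite /ucycleb /= rcons_cat cat_path pp last_rcons /=.
apply/andP; split.
  have := rev_path (@adj G) u (rcons q1 z).
  rewrite last_rcons belast_rcons rev_cons => ->.
  by rewrite (eq_path (e' := @adj G)) // => a b; rewrite adj_sym.
move: pu qu; rewrite /= !cat_uniq !mem_cat !negb_or rev_uniq mem_rev.
rewrite !rcons_uniq !mem_rcons !in_cons !negb_or.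
case/and4P=> /andP[-> _] /andP[-> ->] _ _.
case/and4P=> /andP[/andP[_ ->] _] /andP[zq1 ->] _ _ /=.
rewrite andbT; apply/hasPn => a; rewrite mem_rev => aq1.
rewrite /= mem_rcons in_cons negb_or; apply/andP; split.
  by apply: contraNneq zq1 => <-.
apply: contra p1q => ap1; apply/hasP; exists a => //=.
by rewrite mem_cat mem_rcons in_cons aq1 orbT.
Qed.

(** The search in [gdist] succeeds because a simple path has fewer than [#|G|] edges, and it can
    only stop at the length of the single simple path. *)
Lemma gdist_spath u v p :
  (forall p q, spath u v p -> spath u v q -> p = q) ->
  spath u v p -> gdist u v = size p.
Proof.
move=> uniqp pP; rewrite /gdist; set a := (fun k => _).
have hs : has a (iota 0 #|G|).
  apply/hasP; exists (size p).
    rewrite mem_iota add0n leq0n /=; case/and3P: pP => _ _ pu.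
    by rewrite -[(size p).+1](card_uniqP pu) max_card.
  by apply/existsP; exists (in_tuple p).
have := nth_find 0 hs; rewrite nth_iota ?add0n; last by rewrite -[X in _ < X](size_iota 0) -has_find.
by case/existsP=> q /(uniqp _ _ pP) ->; rewrite size_tuple.
Qed.

(** Leaving [A] means stepping away from [y]; but the path ends at [y], which would then occur
    twice. *)
Lemma cut_spath (A : pred G) y s p :
  (forall a b, adj a b -> A a -> ~~ A b -> a = y) ->
  A s -> spath s y p -> all A p.
Proof.
move=> cut; elim: p s => // x p IH s As /and3P[/= /andP[sx xp] lp /andP[sNp up]].
have Ax : A x.
  apply/negPn/negP => /(cut _ _ sx As) sy; case/negP: sNp.
  by rewrite sy -(eqP lp) mem_last.
by rewrite Ax (IH x) //; apply/and3P.
Qed.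

Lemma spath_rcons u v w p :
  spath u v p -> adj v w -> w \notin u :: p -> spath u w (rcons p w).
Proof.
case/and3P=> pp /eqP pl pu vw wp; rewrite /spath last_rcons eqxx.
by rewrite rcons_path pp pl vw -rcons_cons rcons_uniq wp pu.
Qed.

End SimplePaths.

(** * Earliest arrival along a fixed path *)

Section Arrival.
Variables (G : sgraph) (lam : labeling G).
Hypothesis lamP : periodic1_labeling 2 lam.
Implicit Types (u v w x : G) (p q : seq G) (t : nat).

(** With period 2 the labels of an edge are all odd or all even positive numbers, and membership of
    1 tells which; see [lam_parity]. *)
Definition odd_edge u v : bool := `[< lam [set u; v] 1 >].

Lemma odd_edgeC u v : odd_edge u v = odd_edge v u.
Proof. by rewrite /odd_edge setUC. Qed.

Lemma lam_parity u v t :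
  adj u v -> lam [set u; v] t <-> 0 < t /\ odd t = odd_edge u v.
Proof.
move=> /lamP[i [i12 lamE]].
have oe : odd_edge u v = odd i.
  apply/asboolP/idP => [/lamE[k]|]; first by lia.
  by move=> oi; apply/lamE; exists 0; lia.
rewrite oe lamE; split=> [[k ->]|[t0 ot]]; first by split; lia.
by exists ((t - i) %/ 2); lia.
Qed.

Definition next_time u v t := t + (if odd t == odd_edge u v then 2 else 1).

Lemma next_time_gt u v t : t < next_time u v t.
Proof. by rewrite /next_time; case: ifP; lia. Qed.

Lemma next_time_le u v t : next_time u v t <= t + 2.
Proof. by rewrite /next_time; case: ifP; lia. Qed.

Lemma odd_next_time u v t : odd (next_time u v t) = odd_edge u v.
Proof. by rewrite /next_time; case: eqP; case: (odd_edge u v); lia. Qed.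

Lemma next_time_min u v t t' :
  t < t' -> odd t' = odd_edge u v -> next_time u v t <= t'.
Proof. by rewrite /next_time; case: eqP; lia. Qed.

(** The greedy journey: each edge is crossed at its first label after the current time. *)
Fixpoint arrivals t u p :=
  if p is x :: p' then
    next_time u x t :: arrivals (next_time u x t) x p'
  else [::].

Definition arrival t u p := last t (arrivals t u p).

Lemma arrival_rcons t u p x :
  arrival t u (rcons p x) = next_time (last u p) x (arrival t u p).
Proof. by elim: p t u => //= y p IH t u; rewrite /arrival /= -IH. Qed.

(** Waiting never helps: if [t < t'], the first edge is crossed by [t + 2 <= t' + 1] when starting
    at [t], and not before [t' + 1] when starting at [t']. *)
Lemma arrival_mono t t' u p : t <= t' -> arrival t u p <= arrival t' u p.
Proof.
elim: p t t' u => //= y p IH t t' u tt'; apply: IH.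
have [->//|tNt'] := eqVneq t t'.
apply: leq_trans (next_time_le u y t) (leq_trans _ (next_time_gt u y t')).
by rewrite addn2 !ltnS ltn_neqAle tNt'.
Qed.

Lemma arrivals_journey t u p :
  path (@adj G) u p ->
  [/\ size (arrivals t u p) = size p, path ltn t (arrivals t u p) &
   forall i, i < size p ->
     lam (nth set0 (path_edges u p) i) (nth 0 (arrivals t u p) i)].
Proof.
elim: p t u => //= x p IH t u /andP[ux xp].
have [-> -> lamp] := IH (next_time u x t) x xp.
split=> //; first by rewrite next_time_gt.
case=> [_|i /lamp//] /=; apply/lam_parity => //; split.
  exact: leq_ltn_trans (next_time_gt u x t).
exact: odd_next_time.
Qed.

(** Greedy is optimal: its first crossing is no later than that of any journey, and [arrival_mono]
    carries the advantage along the rest of the path. *)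
Lemma arrival_le t u p ts :
  path (@adj G) u p -> size ts = size p -> path ltn t ts ->
  (forall i, i < size p -> lam (nth set0 (path_edges u p) i) (nth 0 ts i)) ->
  arrival t u p <= last t ts.
Proof.
elim: p t u ts => [|x p IH] t u [|t' ts] // /andP[ux xp] [sz] /andP[tt' sts] lamp.
rewrite -/(arrival _ _ _); apply: (leq_trans _ (IH t' x ts xp sz sts _)).
  apply: arrival_mono; apply: next_time_min => //.
  by have /lam_parity-/(_ ux)[] := lamp 0 isT.
by move=> i; apply: (lamp i.+1).
Qed.

Lemma spath_journey u v p : spath u v p -> is_journey lam u v p (arrivals 0 u p).
Proof.
move=> pP; have /and3P[pp _ _] := pP.
by have [sz /path_sorted st lp] := arrivals_journey 0 pp; split.
Qed.

Lemma dist_t_spath u v p :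
  (forall p q, spath u v p -> spath u v q -> p = q) ->
  spath u v p -> dist_t lam u v = Some (arrival 0 u p).
Proof.
move=> uniqp pP; rewrite /dist_t.
have reach : reaches_at lam u v (arrival 0 u p).
  by exists p, (arrivals 0 u p); split; first exact: spath_journey.
case: pselect => [ex|[]]; last by exists (arrival 0 u p); apply/asboolP.
congr Some; case: ex_minnP => m /asboolP[q [ts [[qP sz sts lamq] <-]]] minm.
apply/eqP; rewrite eqn_leq minm; last exact/asboolP.
rewrite (uniqp _ _ pP qP); have /and3P[pq _ _] := qP.
apply: arrival_le => //.
(* [sorted] does not compare the first time-step with 0; positivity of the labels does. *)
case: ts sz sts lamq {minm} => //= t ts sz -> lamq; rewrite andbT.
case: q sz lamq pq {qP} => // x q _ lamq /= /andP[ux _].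
by have /lam_parity-/(_ ux)[] := lamq 0 isT.
Qed.

End Arrival.

(** * Rooted trees presented by a parent map and a depth function *)

Section RootedTree.
Variables (G : sgraph) (r : G) (par : G -> G) (d : G -> nat).
Implicit Types (u v w x y z s c : G).

(** In a [rooted_tree] the root is its own parent; the first condition keeps it from being its own
    child. *)
Definition kids v : {set G} := [set c | (c != r) && (par c == v)].

Record rooted_tree : Prop := RootedTree {
  par_root : par r = r;
  depth_root : d r = 0;
  depth_par : forall v, v != r -> d v = (d (par v)).+1;
  adj_kids : forall u v, adj u v = (u \in kids v) || (v \in kids u)
}.

Record full_binary (n : nat) : Prop := FullBinary {
  depth_lt : forall v, d v < n;
  card_kids : forall v, d v < n.-1 -> #|kids v| = 2
}.

(** The ancestor comes first: [v] lies in the subtree of [z], possibly with [v = z]. *)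
Definition below z v := fconnect par v z.

Hypothesis rt : rooted_tree.

Lemma kidsP c v : reflect (c != r /\ par c = v) (c \in kids v).
Proof. by rewrite inE; apply: (iffP andP) => -[? /eqP]. Qed.

Lemma kids_par v : v != r -> v \in kids (par v).
Proof. by move=> vr; apply/kidsP. Qed.

Lemma depth_kid c v : c \in kids v -> d c = (d v).+1.
Proof. by case/kidsP=> cr <-; apply: depth_par. Qed.

Lemma adj_par v : v != r -> adj v (par v).
Proof. by move=> vr; rewrite (adj_kids rt) kids_par. Qed.

Lemma below_refl v : below v v. Proof. exact: connect0. Qed.

Lemma below_trans x y z : below x y -> below y z -> below x z.
Proof. by move=> xy yz; apply: connect_trans yz xy. Qed.

Lemma below_kid c v : c \in kids v -> below v c.
Proof. by case/kidsP=> _ <-; apply: fconnect1. Qed.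

Lemma below_par z v : below z v -> v != z -> v != r /\ below z (par v).
Proof.
case/connectP=> -[|x p] /=; first by move=> _ -> /eqP.
case/andP=> /eqP <- pp zE vz; split; last by apply/connectP; exists p.
(* Iterating [par] from the root never moves, so [v = r] would force [z = v]. *)
apply: contraNneq vz => vr; rewrite {}vr (par_root rt) in pp zE *.
rewrite {}zE; elim: p pp => //= y p IH /andP[/eqP].
by rewrite (par_root rt) => <- /IH.
Qed.

Lemma below_depth z v : below z v -> d z <= d v.
Proof.
have [k] := ubnP (d v); elim: k v => // k IH v dv zv.
have [->//|vz] := eqVneq v z; have [vr zp] := below_par zv vz.
rewrite (depth_par rt vr) in dv *; apply: leqW; exact: IH.
Qed.

Lemma below_eq z v : below z v -> d v <= d z -> v = z.
Proof.
move=> zv dvz; apply/eqP/negPn/negP => vz; have [vr zp] := below_par zv vz.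
by move: dvz; rewrite (depth_par rt vr) ltnNge below_depth.
Qed.

Lemma below_toward z v :
  below z v -> v != z -> exists2 c, c \in kids z & below c v.
Proof.
have [k] := ubnP (d v); elim: k v => // k IH v dv zv vz.
have [vr zp] := below_par zv vz.
have [pz|/(IH _ _ zp)[]] := eqVneq (par v) z.
- by exists v; [apply/kidsP | apply: below_refl].
- by rewrite (depth_par rt vr) in dv.
by move=> c cz cp; exists c => //; apply: below_trans cp (below_kid (kids_par vr)).
Qed.

Lemma below_total x y v : below x v -> below y v -> below x y || below y x.
Proof.
have [k] := ubnP (d v); elim: k v => // k IH v dv xv yv.
have [<-|vx] := eqVneq v x; first by rewrite yv orbT.
have [<-|vy] := eqVneq v y; first by rewrite xv.
have [vr xp] := below_par xv vx; have [_ yp] := below_par yv vy.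
by apply: (IH (par v)) => //; rewrite (depth_par rt vr) in dv.
Qed.

Lemma below_root v : below r v.
Proof.
have [k] := ubnP (d v); elim: k v => // k IH v dv.
have [->|vr] := eqVneq v r; first exact: below_refl.
rewrite (depth_par rt vr) in dv.
exact: below_trans (IH (par v) dv) (below_kid (kids_par vr)).
Qed.

Lemma not_below_sibling c c' v s :
  c \in kids v -> c' \in kids v -> c != c' -> below c s -> ~~ below c' s.
Proof.
move=> cv c'v cc' cs; apply/negP => c's; case/negP: cc'.
have dcc' : d c = d c' by rewrite (depth_kid cv) (depth_kid c'v).
have /orP[/below_eq ->|/below_eq ->] := below_total cs c's; by rewrite ?dcc'.
Qed.

(** A subtree is joined to the rest by one edge only; this makes [cut_spath] applicable from either
    side. *)
Lemma leaving_below z a b : adj a b -> below z a -> ~~ below z b -> a = z /\ b = par z.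
Proof.
rewrite (adj_kids rt) => /orP[/kidsP[ar ab]|/kidsP[br ba]] za zb; last first.
  by case/negP: zb; apply: below_trans za (below_kid _); apply/kidsP.
have [az|/(below_par za)[_]] := eqVneq a z; first by rewrite -az.
by rewrite ab => /(negP zb).
Qed.

Lemma entering_below z a b : adj a b -> ~~ below z a -> below z b -> a = par z.
Proof. by rewrite adj_sym => ab za zb; have [] := leaving_below ab zb za. Qed.

(** Both cycle neighbours of a deepest vertex of the cycle would have to be its parent, so the cycle
    would repeat a vertex. *)
Lemma rooted_acyclic (c : seq G) : 2 < size c -> ~~ ucycleb (@adj G) c.
Proof.
case: c => // c0 c1; set c := c0 :: c1 => sz; apply/negP => /andP[cyc unc].
have : c0 \in c by apply: mem_head.
case/(@arg_maxnP _ _ (fun v => v \in c) d) => v vc vmax.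
have up x : x \in c -> adj v x -> x = par v.
  move=> /vmax dx; rewrite (adj_kids rt) => /orP[/kidsP[]//|/depth_kid].
  by move: dx; rewrite /= => + dxE; rewrite dxE ltnn.
have [i c' cE] := rot_to vc; have mc x : x \in v :: c' -> x \in c by rewrite -cE mem_rot.
move: cyc unc sz; rewrite -(rot_cycle i) -(rot_uniq i) -(size_rot i) cE.
case: c' mc {cE} => // x [//|y c'] mc /=; rewrite rcons_path => /and3P[vx _ /andP[_ lv]].
move=> /and3P[_ xN _] _; case/negP: xN.
have lE : last y c' = par v.
  by apply: up; [apply: mc; rewrite 2!in_cons mem_last !orbT | rewrite adj_sym].
rewrite (up x _ vx) -?lE ?mem_last //.
by apply: mc; rewrite !in_cons eqxx orbT.
Qed.

Lemma rooted_connected u v : connect (@adj G) u v.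
Proof.
have cr w : connect (@adj G) w r.
  have [k] := ubnP (d w); elim: k w => // k IH w dw.
  have [->|wr] := eqVneq w r; first exact: connect0.
  rewrite (depth_par rt wr) in dw.
  exact: connect_trans (connect1 (adj_par wr)) (IH _ dw).
by apply: connect_trans (cr u) _; rewrite (sym_connect_sym (@adj_sym G)).
Qed.

Lemma rooted_is_tree : is_tree G.
Proof. by split; [apply: rooted_connected | apply: rooted_acyclic]. Qed.

Definition rooted_spath_unique := spath_unique rooted_acyclic.

(** By [cut_spath] the path to [y] stays in the subtree of [y], so [par y] is a new vertex. The
    downward case is dual. *)
Lemma spath_up s y p :
  below y s -> y != r -> spath s y p -> spath s (par y) (rcons p (par y)).
Proof.
move=> ys yr sp; have Np : ~~ below y (par y).
  by apply/negP => /below_depth; rewrite (depth_par rt yr) ltnn.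
apply: (spath_rcons sp (adj_par yr)).
have /allP allp : all (below y) p.
  by apply: (cut_spath _ ys sp) => a b ab ya yb; have [] := leaving_below ab ya yb.
rewrite in_cons negb_or; apply/andP; split; first by apply: contraNneq Np => ->.
by apply: contra Np => /allp.
Qed.

Lemma spath_down s w p :
  ~~ below w s -> spath s (par w) p -> spath s w (rcons p w).
Proof.
move=> ws sp; have wr : w != r by apply: contraNneq ws => ->; apply: below_root.
apply: (spath_rcons sp); first by rewrite adj_sym adj_par.
have /allP allp : all (fun v => ~~ below w v) p.
  apply: (cut_spath _ ws sp) => a b ab wa; rewrite negbK; exact: entering_below ab wa.
rewrite in_cons negb_or; apply/andP; split; first by apply: contraNneq ws => <-; apply: below_refl.
by apply/negP => /allp; rewrite below_refl.
Qed.

Lemma gdist_root v : gdist r v = d v.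
Proof.
suff [p pP <-] : exists2 p, spath r v p & size p = d v.
  by apply: gdist_spath pP; apply: rooted_spath_unique.
have [k] := ubnP (d v); elim: k v => // k IH v dv.
have [->|vr] := eqVneq v r; first by exists [::]; rewrite ?(depth_root rt) ?/spath /= ?eqxx.
rewrite (depth_par rt vr) in dv *; have [p pP <-] := IH _ dv.
exists (rcons p v); last by rewrite size_rcons.
apply: spath_down pP; apply: contra vr => /below_eq ->//.
by rewrite (depth_root rt).
Qed.

Lemma children_kids v : children r v = kids v.
Proof.
apply/setP=> c; rewrite inE !gdist_root (adj_kids rt).
apply/andP/idP => [[/orP[/depth_kid ->|//]]|cv].
  by rewrite -addn2 -[X in X == _]addn0 eqn_add2l.
by rewrite cv orbT (depth_kid cv).
Qed.

(** By induction: [par] splits level [k + 1] into the pairs [kids v], one for each [v] of level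
    [k]. *)
Lemma card_level m :
  (forall v, d v < m -> #|kids v| = 2) ->
  forall k, k <= m -> #|[set v | d v == k]| = 2 ^ k.
Proof.
move=> k2; elim=> [_|k IH km].
  rewrite (_ : [set v | _] = [set r]) ?cards1 //; apply/setP=> v; rewrite !inE.
  by have [->|vr] := eqVneq v r; rewrite ?(depth_root rt) ?(depth_par rt vr).
rewrite expnS mulnC -(IH (ltnW km)) -sum_nat_const.
rewrite -sum1_card (partition_big par (mem [set v | d v == k])) /=; last first.
  move=> v; rewrite !inE; have [->|vr] := eqVneq v r; first by rewrite (depth_root rt).
  by rewrite (depth_par rt vr) eqSS.
apply: eq_bigr => v; rewrite inE => /eqP dv; rewrite -(k2 v) ?dv // -sum1_card.
apply: eq_bigl => c; rewrite !inE; have [->|cr] := eqVneq c r.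
  by rewrite (depth_root rt).
by rewrite (depth_par rt cr) eqSS; case: (par c =P v) => [->|]; rewrite ?dv ?eqxx ?andbF.
Qed.

(** * Full binary trees *)

Section Full.
Variable n : nat.
Hypothesis (n_gt0 : 0 < n) (fb : full_binary n).

Lemma full_kids v : d v < n.-1 -> exists a b,
  [/\ a \in kids v, b \in kids v, a != b & forall c, c \in kids v -> c = a \/ c = b].
Proof.
move=> /(card_kids fb)/eqP/cards2P[a [b [ab ->]]]; exists a, b.
by split=> //; rewrite ?inE ?eqxx ?orbT // => c; rewrite !inE => /orP[]/eqP; auto.
Qed.

Lemma full_other_kid c v :
  c \in kids v -> exists2 c', c' \in kids v & c' != c.
Proof.
move=> cv; have [|a [b [av bv ab kE]]] := @full_kids v.
  by have := depth_lt fb c; rewrite (depth_kid cv); lia.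
by have [->|->] := kE c cv; [exists b; rewrite 1?eq_sym | exists a].
Qed.

Lemma full_level k : k < n -> #|[set v | d v == k]| = 2 ^ k.
Proof. move=> kn; apply: (@card_level n.-1); [exact: (card_kids fb) | lia]. Qed.

Lemma leaf_kids v : d v = n.-1 -> kids v = set0.
Proof.
move=> dv; apply/setP=> c; rewrite in_set0; apply/negP => /depth_kid.
by have := depth_lt fb c; lia.
Qed.

Lemma leaf_below v u : d v = n.-1 -> below v u -> u = v.
Proof. by move=> dv vu; apply: below_eq => //; have := depth_lt fb u; lia. Qed.

Lemma full_cbt : #|G| = 2 ^ n - 1 -> complete_binary_tree G n.
Proof.
move=> cG; split=> //; split; first exact: rooted_is_tree.
have leavesE : leaves r = [set v | d v == n.-1].
  apply/setP=> v; rewrite !inE children_kids; apply/eqP/eqP => [k0|/leaf_kids//].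
  have dv := depth_lt fb v; have [/(card_kids fb)| |//] := ltngtP (d v) n.-1; last by lia.
  by rewrite k0 cards0.
exists r; split=> [v||v]; rewrite leavesE.
- rewrite inE => dv; rewrite children_kids (card_kids fb) //.
  by have := depth_lt fb v; lia.
- by rewrite full_level //; lia.
by rewrite inE gdist_root => /eqP.
Qed.

End Full.
End RootedTree.

Arguments kidsP {G r par c v}.

(** * From the graph-theoretic definitions to parent and depth *)

Lemma tree_rooted (G : sgraph) (r : G) :
  is_tree G -> exists par d, rooted_tree r par d.
Proof.
move=> [conn acyc]; have ex v := connect_spath (conn r v).
pose P v := xchoose (ex v); have PP v : spath r v (P v) := xchooseP (ex v).
have PE v p : spath r v p -> P v = p := spath_unique acyc (PP v).
(* The parent is the penultimate vertex of the simple path [P v] from [r]; for the empty path the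
   default makes [r] its own parent. *)
pose par v := last r (belast r (P v)); pose d v := size (P v).
have Pr : P r = [::] := spath_nil (PP r).
have parP v : v != r -> P v = rcons (P (par v)) v /\ adj (par v) v.
  move=> vr; move: (PP v); rewrite /par; case/lastP: (P v) => [|p w].
    by case/and3P=> _ /eqP /= rv; rewrite rv eqxx in vr.
  case/and3P; rewrite rcons_path last_rcons belast_rcons => /andP[pp aw] /eqP wv.
  subst w; rewrite -rcons_cons rcons_uniq => /andP[_ pu].
  by rewrite (PE _ p) //; apply/and3P.
exists par, d; split=> [|||u v].
- by rewrite /par Pr.
- by rewrite /d Pr.
- by move=> v /parP[vE _]; rewrite /d {1}vE size_rcons.
apply/idP/orP; last first.
  by case=> /kidsP[/parP[_ +] <-] //; rewrite adj_sym.
(* If [v] is not on the path to [u], that path extends to [v] and [u] is the parent of [v].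
   Otherwise its part after [v] is the single edge to [u], by uniqueness, and [v] is the parent of
   [u]. *)
move=> uv; have := PP u; have [vp|vp] := boolP (v \in r :: P u); last first.
  move=> /spath_rcons/(_ uv vp)/PE vE; right; apply/kidsP.
  have vr : v != r by apply: contraNneq vp => ->; apply: mem_head.
  have [vE' _] := parP v vr; split=> //.
  have /and3P[_ /eqP lu _] := PP u; have /and3P[_ /eqP lp _] := PP (par v).
  by rewrite -lu -[LHS]lp; move: vE'; rewrite vE => /rcons_inj[->].
case/splitPl: (vp) => p1 p2 lp1 /and3P[]; rewrite cat_path last_cat lp1.
move=> /andP[pp1 pp2] /eqP lp2; rewrite -cat_cons cat_uniq => /and3P[up1 Np2 up2].
have p2E : p2 = [:: u].
  apply: (spath_unique acyc (u := v) (v := u)); apply/and3P; split=> //=.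
  - by rewrite lp2 eqxx.
  - rewrite up2 andbT; apply: contra Np2 => vp2; apply/hasP; exists v => //=.
    by rewrite -lp1 mem_last.
  - by rewrite adj_sym uv.
  by rewrite inE andbT; apply/eqP => vu; rewrite vu adj_irr in uv.
left; apply/kidsP.
have uP : P u = rcons p1 u.
  apply: PE; rewrite p2E /= in pp2 Np2; rewrite orbF in Np2.
  apply: (spath_rcons (v := v)) => //; first by apply/and3P; rewrite lp1 eqxx.
  by rewrite adj_sym.
have ur : u != r by apply/eqP => ur; move: uP; rewrite ur Pr => /(congr1 size); rewrite size_rcons.
split=> //; have [uE _] := parP u ur; rewrite uE in uP.
have /and3P[_ /eqP lp _] := PP (par u).
by rewrite -[LHS]lp; have [->] := rcons_inj uP.
Qed.

(** The leaves are contained in level [n - 1] and equal it in number, so they fill it. A vertex of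
    greater depth would have an ancestor on that level that is not a leaf. *)
Lemma cbt_rooted (G : sgraph) n :
  0 < n -> complete_binary_tree G n ->
  exists (r : G) (par : G -> G) (d : G -> nat),
    rooted_tree r par d /\ full_binary r par d n.
Proof.
move=> n0 [_ [treeG [r [kids2 cleaves dleaves]]]].
have [par [d rt]] := tree_rooted r treeG; exists r, par, d; split=> //.
have k2 v : d v < n.-1 -> #|kids r par v| = 2.
  move=> dv; rewrite -(children_kids rt) kids2 //.
  by apply/negP => /dleaves; rewrite (gdist_root rt) => dE; rewrite dE ltnn in dv.
have leavesE : leaves r = [set v | d v == n.-1].
  apply/eqP; rewrite eqEcard cleaves (card_level rt k2) // leqnn andbT.
  by apply/subsetP=> v /dleaves; rewrite (gdist_root rt) inE => ->.
split=> // v; have [k] := ubnP (d v); elim: k v => // k IH v dv.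
have [->|vr] := eqVneq v r; first by rewrite (depth_root rt).
rewrite (depth_par rt vr) in dv *; have := IH (par v) dv.
rewrite leq_eqVlt => /orP[/eqP pn|//].
have : par v \in leaves r by rewrite leavesE inE -pn.
rewrite inE (children_kids rt) => /eqP k0.
by have := kids_par par vr; rewrite k0 inE.
Qed.

(** * Temporal distances and resolving sets in a rooted tree *)

Section TemporalDistance.
Variables (G : sgraph) (lam : labeling G) (r : G) (par : G -> G) (d : G -> nat).
Hypotheses (lamP : periodic1_labeling 2 lam) (rt : rooted_tree r par d).
Implicit Types (u v w x y z s c : G) (R : {set G}).

Local Notation kids := (kids r par).
Local Notation below := (below par).
Local Notation next_time := (next_time lam).

(** By [dist_tE] every temporal distance in the tree is finite, so the default 0 never hides an
    infinite one. *)
Definition tdist s v := odflt 0 (dist_t lam s v).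

Lemma tdist_spath s v p : spath s v p -> tdist s v = arrival lam 0 s p.
Proof.
by move=> sp; rewrite /tdist (dist_t_spath lamP _ sp) //; apply: rooted_spath_unique rt _ _.
Qed.

Lemma dist_tE s v : dist_t lam s v = Some (tdist s v).
Proof.
have [p sp] := connect_spath (rooted_connected rt s v).
by rewrite /tdist (dist_t_spath lamP _ sp) //; apply: rooted_spath_unique rt _ _.
Qed.

Lemma tdist_refl s : tdist s s = 0.
Proof. by rewrite (@tdist_spath _ _ [::]) // /spath /= eqxx. Qed.

Lemma tdist_up s y :
  below y s -> y != r -> tdist s (par y) = next_time y (par y) (tdist s y).
Proof.
move=> ys yr; have [p sp] := connect_spath (rooted_connected rt s y).
rewrite (tdist_spath (spath_up rt ys yr sp)) arrival_rcons -(tdist_spath sp).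
by have /and3P[_ /eqP-> _] := sp.
Qed.

Lemma tdist_down s w :
  ~~ below w s -> tdist s w = next_time (par w) w (tdist s (par w)).
Proof.
move=> ws; have [p sp] := connect_spath (rooted_connected rt s (par w)).
rewrite (tdist_spath (spath_down rt ws sp)) arrival_rcons -(tdist_spath sp).
by have /and3P[_ /eqP-> _] := sp.
Qed.

Lemma tdist_up_lt s y : below y s -> y != r -> tdist s y < tdist s (par y).
Proof. by move=> ys yr; rewrite tdist_up // next_time_gt. Qed.

Lemma tdist_down_lt s w : ~~ below w s -> tdist s (par w) < tdist s w.
Proof. by move=> ws; rewrite [ltnRHS]tdist_down // next_time_gt. Qed.

(** The path from [s] to [v] passes through [y]. The induction steps back from [v] along it: to the
    child towards [y] if [v] is an ancestor of [s], to [par v] otherwise. *)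
Lemma tdist_leave s y v : below y s -> ~~ below y v -> tdist s y < tdist s v.
Proof.
have [k] := ubnP (tdist s v); elim: k v => // k IH v dv ys yv.
have [vs|vs] := boolP (below v s).
  have /orP[|vy] := below_total rt ys vs; first by rewrite (negPf yv).
  have yNv : y != v by apply: contraNneq yv => ->; apply: below_refl.
  have [c /kidsP[cr cv] cy] := below_toward rt vy yNv.
  have lt_cv : tdist s c < tdist s v.
    by rewrite -cv; apply: tdist_up_lt => //; apply: below_trans cy ys.
  have [<-//|cNy] := eqVneq c y.
  apply: ltn_trans (lt_cv); apply: IH => //; first exact: leq_trans lt_cv _.
  by apply: contra cNy => yc; rewrite (below_eq rt yc (below_depth rt cy)).
have lt_pv := tdist_down_lt vs.
have [<-//|pNy] := eqVneq (par v) y.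
apply: ltn_trans (lt_pv); apply: IH => //; first exact: leq_trans lt_pv _.
have vr : v != r by apply: contraNneq vs => ->; apply: below_root rt _.
by apply: contra yv => yp; apply: below_trans yp (below_kid (kids_par par vr)).
Qed.

(** From outside, the subtree of [c] is entered only through [u]. *)
Lemma tdist_enter s c u v :
  c \in kids u -> below c v -> ~~ below c s -> tdist s u < tdist s v.
Proof.
move=> /kidsP[cr cu]; have [k] := ubnP (d v); elim: k v => // k IH v dv cv cs.
have vs : ~~ below v s by apply: contra cs; apply: below_trans.
apply: leq_ltn_trans (tdist_down_lt vs).
have [->|vc] := eqVneq v c; first by rewrite cu.
have [vr cp] := below_par rt cv vc; apply: ltnW; apply: IH => //.
by rewrite (depth_par rt vr) in dv.
Qed.

(** The tree is connected, so one source reaches every vertex and the covering condition amounts to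
    nonemptiness. *)
Lemma resolvingP R :
  temporal_resolving lam R <->
  (exists s, s \in R) /\
  (forall u v, u <> v -> exists2 s, s \in R & tdist s u <> tdist s v).
Proof.
split=> [[reach res]|[[s sR] res]]; split.
- by have [s [_ [_ [sR _]]]] := reach r; exists s.
- by move=> u v /res[s sR]; rewrite !dist_tE => suv; exists s => // e; rewrite e in suv.
- move=> v; have [p sp] := connect_spath (rooted_connected rt s v).
  by exists s, p, (arrivals lam 0 s p); split=> //; apply: spath_journey.
by move=> u v /res[s' s'R suv]; exists s' => //; rewrite !dist_tE => -[].
Qed.

(** This validates the default candidate in [temporal_dim]: a vertex is the only one at distance 0
    from itself. *)
Lemma resolving_setT : temporal_resolving lam [set: G].
Proof.
apply/resolvingP; split; first by exists r; rewrite inE.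
move=> u v uv; exists u; rewrite ?inE // tdist_refl => e.
have [vu|vu] := boolP (below v u).
  have [|c /kidsP[cr cv] cu] := below_toward rt vu; first exact/eqP.
  by have := tdist_up_lt cu cr; rewrite cv -e.
by have := tdist_down_lt vu; rewrite -e.
Qed.

Lemma temporal_dim_le R : temporal_resolving lam R -> temporal_dim lam <= #|R|.
Proof.
move=> Rres; rewrite /temporal_dim; case: arg_minnP => [|R' _ minR].
  by apply/asboolP/resolving_setT.
exact/minR/asboolP.
Qed.

Lemma temporal_dim_ge m :
  (forall R, temporal_resolving lam R -> m <= #|R|) -> m <= temporal_dim lam.
Proof.
move=> mR; rewrite /temporal_dim; case: arg_minnP => [|R' /asboolP/mR//].
by apply/asboolP/resolving_setT.
Qed.

End TemporalDistance.

(** * Both bounds for an arbitrary labeling, and the extremal labelings *)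

Section Bounds.
Variables (G : sgraph) (lam : labeling G) (r : G) (par : G -> G) (d : G -> nat).
Variable n : nat.
Hypotheses (lamP : periodic1_labeling 2 lam) (rt : rooted_tree r par d).
Hypotheses (n_gt1 : 1 < n) (fb : full_binary r par d n).
Implicit Types (u v w x y z s a b c : G) (R : {set G}).

Local Notation kids := (kids r par).
Local Notation below := (below par).
Local Notation tdist := (tdist lam).
Local Notation odd_edge := (odd_edge lam).

Let n_gt0 : 0 < n := ltnW n_gt1.

Lemma two_kids v a b c :
  a \in kids v -> b \in kids v -> a != b -> c \in kids v -> c = a \/ c = b.
Proof.
move=> av bv ab cv; have [|a' [b' [_ _ _ kE]]] := full_kids fb (v := v).
  by have := depth_lt fb c; rewrite (depth_kid rt cv); lia.
by move: ab; have [->|->] := kE a av; have [->|->] := kE b bv;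
  have [->|->] := kE c cv; rewrite ?eqxx; auto.
Qed.

Lemma depth0_root v : d v = 0 -> v = r.
Proof. by move=> dv; apply/eqP/negPn/negP => vr; rewrite (depth_par rt vr) in dv. Qed.

Lemma descendant_at u k : d u <= k < n -> exists2 w, below u w & d w = k.
Proof.
elim: k => [|k IH] /andP[uk kn].
  by exists u; [apply: below_refl | lia].
have [<-|uk1] := eqVneq (d u) k.+1; first by exists u => //; apply: below_refl.
have [|w uw dw] := IH; first by lia.
have [|c [_ [cw _ _ _]]] := full_kids fb (v := w); first by lia.
exists c; last by rewrite (depth_kid rt cw) dw.
exact: below_trans uw (below_kid cw).
Qed.

Lemma ancestor_at u k : k <= d u -> exists2 x, below x u & d x = k.
Proof.
have [m] := ubnP (d u); elim: m u => // m IH u um ku.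
have [dk|dk] := eqVneq (d u) k; first by exists u => //; apply: below_refl.
have ur : u != r by apply: contraNneq dk => ur; move: ku; rewrite ur (depth_root rt); case: (k).
have dE := depth_par rt ur.
have [||x xp dx] := IH (par u); try lia.
by exists x => //; apply: below_trans xp (below_kid (kids_par par ur)).
Qed.

Lemma iter_par_below x s : below x s -> iter (d s - d x) par s = x.
Proof.
have [m] := ubnP (d s); elim: m s => // m IH s sm xs.
have [->|sx] := eqVneq s x; first by rewrite subnn.
have [sr xp] := below_par rt xs sx; have dE := depth_par rt sr.
rewrite dE subSn ?(below_depth rt xp) // iterSr IH //; lia.
Qed.

Lemma below_same_depth x y s : below x s -> below y s -> d x = d y -> x = y.
Proof.
by move=> xs ys dxy; rewrite -(iter_par_below xs) -(iter_par_below ys) dxy.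
Qed.

(** Sending a source to its ancestor of depth [k] maps [R] onto a set containing the whole level. *)
Lemma card_meets_level R k :
  k < n -> (forall x, d x = k -> exists2 s, s \in R & below x s) -> 2 ^ k <= #|R|.
Proof.
move=> kn meets; rewrite -(full_level rt n_gt0 fb kn).
apply: leq_trans (leq_imset_card (fun s => iter (d s - k) par s) R).
apply/subset_leq_card/subsetP=> x; rewrite inE => /eqP dx.
have [s sR xs] := meets x dx; apply/imsetP; exists s => //.
by rewrite -dx iter_par_below.
Qed.

Lemma not_below_leaf v s : d v = n.-1 -> s != v -> ~~ below v s.
Proof. by move=> dv; apply: contra => /(leaf_below rt n_gt0 fb dv)->. Qed.

Lemma tdist_descend s y v :
  ~~ below y s -> below y v -> tdist s y + (d v - d y) <= tdist s v.
Proof.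
move=> ys; have [m] := ubnP (d v); elim: m v => // m IH v vm yv.
have [->|vy] := eqVneq v y; first by rewrite subnn addn0.
have [vr yp] := below_par rt yv vy; have dE := depth_par rt vr.
have vs : ~~ below v s by apply: contra ys; apply: below_trans.
have := tdist_down_lt lamP rt vs; have := below_depth rt yp.
by have /(_ _ yp) := IH (par v); lia.
Qed.

Lemma leave_resolves R u v :
  (exists2 s, s \in R & below u s) -> ~~ below u v ->
  exists2 s, s \in R & tdist s u <> tdist s v.
Proof.
case=> s sR us uv; exists s => // e.
by have := tdist_leave lamP rt us uv; rewrite e ltnn.
Qed.

Lemma enter_resolves R u c c' v :
  c \in kids u -> c' \in kids u -> c' != c -> below c v ->
  (exists2 s, s \in R & below c' s) ->
  exists2 s, s \in R & tdist s u <> tdist s v.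
Proof.
move=> cu c'u cc' cv [s sR c's]; exists s => // e.
have cs := not_below_sibling rt c'u cu cc' c's.
by have := tdist_enter lamP rt cu cv cs; rewrite e ltnn.
Qed.

Lemma temporal_dim_upper : temporal_dim lam <= 2 ^ (n - 2).
Proof.
(* An arbitrary child; at depth [n - 2] one exists, so the default [w] does not occur in [R]. *)
pose f w := odflt w [pick c in kids w].
pose R := [set f w | w in [set w | d w == n - 2]].
have fP w : d w = n - 2 -> f w \in R /\ f w \in kids w.
  move=> dw; split; first by apply/imsetP; exists w; rewrite ?inE ?dw.
  rewrite /f; case: pickP => [//|k0].
  have [|a [_ [aw _ _ _]]] := full_kids fb (v := w); first by lia.
  by have := k0 a; rewrite aw.
have cov u : (d u < n.-1) || (u \in R) -> exists2 s, s \in R & below u s.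
  case/orP=> [du|uR]; last by exists u => //; apply: below_refl.
  have [|w uw dw] := @descendant_at u (n - 2); first by lia.
  have [fR fk] := fP w dw; exists (f w) => //.
  exact: below_trans uw (below_kid fk).
have leafP u : ~~ ((d u < n.-1) || (u \in R)) -> d u = n.-1 /\ u \notin R.
  by rewrite negb_or => /andP[du ->]; split=> //; have := depth_lt fb u; lia.
have covered u v : (d u < n.-1) || (u \in R) -> u <> v ->
    exists2 s, s \in R & tdist s u <> tdist s v.
  move=> uR uv; have [uv'|] := boolP (below u v); last exact: leave_resolves (cov _ uR).
  have [|c cu cv] := below_toward rt uv'; first by apply/eqP => vu; apply: uv.
  have [c' c'u cc'] := full_other_kid rt n_gt0 fb cu.
  have [/cov c'R|/leafP[dc' c'R]] := boolP ((d c' < n.-1) || (c' \in R)).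
    exact: (enter_resolves cu c'u cc' cv).
  (* Here [c'] is an unselected leaf, so [v = c] is its selected sibling and itself separates [v]
     from [u]. *)
  have dc : d c = n.-1 by rewrite (depth_kid rt cu) -dc' (depth_kid rt c'u).
  have vc := leaf_below rt n_gt0 fb dc cv; subst v.
  have [|fR fk] := fP u; first by have := depth_kid rt cu; lia.
  have [fE|fE] := two_kids c'u cu cc' fk; first by rewrite fE (negPf c'R) in fR.
  rewrite fE in fR; have uc : u != c by apply/eqP.
  have [|s sR ns] := @leave_resolves R c u _ (not_below_leaf dc uc).
    by exists c => //; apply: below_refl.
  by exists s => // e; apply: ns.
have resR u v : u <> v -> exists2 s, s \in R & tdist s u <> tdist s v.
  move=> uv.
  have [/covered/(_ uv)//|/leafP[du uR]] := boolP ((d u < n.-1) || (u \in R)).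
  have [/covered/(_ (nesym uv))[s sR ns]|/leafP[dv vR]] :=
    boolP ((d v < n.-1) || (v \in R)); first by exists s => // e; apply: ns.
  have ur : u != r by apply: contraTneq n_gt1 => ur; rewrite ur (depth_root rt) in du; lia.
  have vr : v != r by apply: contraTneq n_gt1 => vr; rewrite vr (depth_root rt) in dv; lia.
  have [dEu dEv] := (depth_par rt ur, depth_par rt vr).
  have [|sR sk] := fP (par u); first by lia.
  (* Two unselected leaves remain. From [s], the selected sibling of [u], the leaf [u] is reached at
     most 2 after [par u], but [v] at least 3 after it, since [par (par v)], [par v] and [v] are all
     reached later than [par u], in this order. *)
  set s := f (par u) in sR sk; exists s => // e.
  have su : s != u by apply: contraNneq uR => <-.
  have sv : s != v by apply: contraNneq vR => <-.
  have pNp : par v != par u.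
    apply: contraNneq vR => pE; have vk : v \in kids (par u) by rewrite -pE kids_par.
    have [->//|vu] := two_kids sk (kids_par par ur) su vk.
    by case: uv.
  have dpE : d (par v) = d (par u) by apply: eq_add_S; rewrite -dEv dv -du.
  have pvr : par v != r.
    apply: contraNneq pNp => pr; rewrite pr (@depth0_root (par u)) //.
    by rewrite -dpE pr (depth_root rt).
  have dEpv := depth_par rt pvr.
  have pvs : ~~ below (par v) s.
    by apply: contra pNp => pvs; apply/eqP/(below_same_depth pvs (below_kid sk)).
  have gNp : ~~ below (par u) (par (par v)).
    by apply/negP => /(below_depth rt); rewrite -dpE dEpv ltnn.
  have := tdist_leave lamP rt (below_kid sk) gNp.
  have := tdist_down_lt lamP rt pvs.
  have := tdist_down_lt lamP rt (not_below_leaf dv sv).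
  have := next_time_le lam (par u) u (tdist s (par u)).
  rewrite -(tdist_down lamP rt (not_below_leaf du su)) e; clear; lia.
apply: (leq_trans (temporal_dim_le lamP rt (R := R) _)).
  apply/(resolvingP lamP rt); split=> //.
  by have [s sR _] := cov r ltac:(rewrite (depth_root rt); lia); exists s.
apply: leq_trans (leq_imset_card _ _) _; rewrite (full_level rt n_gt0 fb) //; lia.
Qed.

(** * The lower bound, and equality with the upper bound for constant labels *)

(** With no source below [w], both children are reached from [w]; equal parities would give equal
    delays and leave them unseparated. *)
Lemma kids_labels_differ R w a b :
  temporal_resolving lam R -> (forall s, s \in R -> ~~ below w s) ->
  a \in kids w -> b \in kids w -> a != b -> odd_edge w a != odd_edge w b.
Proof.
move=> /(resolvingP lamP rt)[_ res] Nw aw bw ab; apply/eqP => e.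
have [|s sR] := res a b; first exact/eqP.
have Ns c : c \in kids w -> ~~ below c s.
  by move=> cw; apply: contra (Nw s sR); apply: below_trans (below_kid cw).
rewrite (tdist_down lamP rt (Ns a aw)) (tdist_down lamP rt (Ns b bw)).
have [[_ ->] [_ ->]] := (kidsP aw, kidsP bw).
by rewrite /next_time e.
Qed.

(* Outside the subtree at [w], all of [R] enters [w] through the same edge, hence at times of
   the same parity, so the delays to the children of [w] do not depend on the source. *)
Lemma uniform_kids R w :
  temporal_resolving lam R -> (forall s, s \in R -> ~~ below w s) -> d w < n.-1 ->
  exists a b, [/\ a \in kids w, b \in kids w &
    forall s, s \in R -> tdist s a = tdist s w + 1 /\ tdist s b = tdist s w + 2].
Proof.
move=> Rres Nw dw; have [a [b [aw bw ab _]]] := full_kids fb dw.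
have step c s : c \in kids w -> s \in R ->
    tdist s c = tdist s w + if odd_edge (par w) w == odd_edge w c then 2 else 1.
  move=> cw sR; have Ns := Nw s sR.
  have cs : ~~ below c s by apply: contra Ns; apply: below_trans (below_kid cw).
  rewrite (tdist_down lamP rt cs); have [_ ->] := kidsP cw.
  by rewrite /next_time (tdist_down lamP rt Ns) odd_next_time.
have := kids_labels_differ Rres Nw aw bw ab.
(* The child with delay 1 is the one whose edge differs in parity from the edge above [w]. *)
case: (eqVneq (odd_edge (par w) w) (odd_edge w a)) => [ea eb|ea eb].
  exists b, a; split=> // s sR; rewrite (step _ _ bw sR) (step _ _ aw sR) ea eqxx.
  by rewrite (negPf eb).
exists a, b; split=> // s sR; rewrite (step _ _ aw sR) (step _ _ bw sR) (negPf ea).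
by move: ea eb; case: odd_edge; case: odd_edge; case: odd_edge.
Qed.

Lemma resolving_meets_block R x :
  2 < n -> temporal_resolving lam R -> d x = n - 3 -> exists2 s, s \in R & below x s.
Proof.
move=> n_gt2 Rres dx; apply: contrapT => Nx.
have {}Nx s : s \in R -> ~~ below x s by move=> sR; apply/negP => xs; apply: Nx; exists s.
have [|a [b [ax bx ab]]] := uniform_kids Rres Nx; first by lia.
have da := depth_kid rt ax; have db := depth_kid rt bx.
have [||a1 [a2 [a1a _ a1E]]] := uniform_kids (w := a) Rres.
- by move=> s /Nx; apply: contra; apply: below_trans (below_kid ax).
- by lia.
have /(resolvingP lamP rt)[_ /(_ a1 b)] := Rres.
case=> [a1b|s sR]; first by have := depth_kid rt a1a; rewrite a1b; lia.
(* From every source, [a1] is reached 1 + 1 after [x] and [b] is reached 2 after [x]. *)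
by have [-> _] := a1E s sR; have [-> ->] := ab s sR; rewrite -addnA.
Qed.

Lemma temporal_dim_lower : 2 < n -> 2 ^ (n - 3) <= temporal_dim lam.
Proof.
move=> n_gt2; apply: (temporal_dim_ge lamP rt) => R Rres.
apply: card_meets_level => [|x]; [lia | exact: resolving_meets_block].
Qed.

Lemma temporal_dim_gt0 : 0 < temporal_dim lam.
Proof.
apply: (temporal_dim_ge lamP rt) => R /(resolvingP lamP rt)[[s sR] _].
by apply/card_gt0P; exists s.
Qed.

Lemma temporal_dim_constant :
  (forall u v, odd_edge u v) -> temporal_dim lam = 2 ^ (n - 2).
Proof.
move=> lam1; apply/eqP; rewrite eqn_leq temporal_dim_upper /=.
apply: (temporal_dim_ge lamP rt) => R Rres.
apply: card_meets_level => [|w dw]; first by lia.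
apply: contrapT => Nw; have {}Nw s : s \in R -> ~~ below w s.
  by move=> sR; apply/negP => ws; apply: Nw; exists s.
have [|a [b [aw bw ab _]]] := full_kids fb (v := w); first by lia.
by have := kids_labels_differ Rres Nw aw bw ab; rewrite !lam1.
Qed.

(** * Alternating labels attain the lower bound *)

Section Alternating.
Variable left : pred G.
Hypothesis left_edge : forall v, v != r -> odd_edge (par v) v = left v.
Hypothesis left_kids :
  forall v a b, a \in kids v -> b \in kids v -> a != b -> left a != left b.

(** For [3 <= n], one leaf for each vertex of depth [n - 3]: the left child of its left child. *)
Let R : {set G} := [set s | [&& d s == n.-1, left s & left (par s)]].

Lemma left_right_kids v : d v < n.-1 -> exists a b,
  [/\ a \in kids v, b \in kids v, left a & ~~ left b].
Proof.
move=> /(full_kids fb)[a [b [av bv ab _]]]; have lab := left_kids av bv ab.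
have [la|la] := boolP (left a); [exists a, b | exists b, a]; split=> //.
  by rewrite la in lab; case: (left b) lab.
by rewrite (negPf la) in lab; case: (left b) lab.
Qed.

Lemma left_kid_inj v a b :
  a \in kids v -> b \in kids v -> left a -> left b -> a = b.
Proof.
move=> av bv la lb; apply/eqP/negPn/negP => /(left_kids av bv).
by rewrite la lb.
Qed.

Lemma below_cases v a b y :
  a \in kids v -> b \in kids v -> a != b -> below v y ->
  [\/ y = v, below a y | below b y].
Proof.
move=> av bv ab vy; have [->|yv] := eqVneq y v; first exact: Or31.
have [c cv cy] := below_toward rt vy yv.
by have [<-|<-] := two_kids av bv ab cv; [apply: Or32 | apply: Or33].
Qed.

(** From the source [a1] the vertices [a1], [a], [a2], [x], [b], [b1], [b2] are reached at times 0,
    1, 2, 3, 4, 5, 6. Leaves and inner vertices get separate bounds, both needed when different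
    blocks are compared. *)
Lemma left_block x : 2 < n -> d x = n - 3 -> exists2 s, s \in R &
  [/\ below x s, tdist s x = 3,
      forall y, below x y -> tdist s y <= (if d y == n.-1 then 6 else 4) &
      forall y z, below x y -> below x z -> tdist s y = tdist s z -> y = z].
Proof.
move=> n_gt2 dx.
have [|a [b [ax bx la lb]]] := @left_right_kids x; first by lia.
have dkid c : c \in kids x -> d c = n - 2.
  by move=> /(depth_kid rt)->; rewrite dx -subSn.
have dleaf c v : v \in kids x -> c \in kids v -> d c = n.-1.
  by move=> /dkid dv /(depth_kid rt)->; rewrite dv -subSn // subSS subn1.
have lt_dkid c : c \in kids x -> d c < n.-1.
  by move/dkid->; rewrite -subn1 ltn_sub2l.
have [a1 [a2 [a1a a2a la1 la2]]] := left_right_kids (lt_dkid a ax).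
have [b1 [b2 [b1b b2b lb1 lb2]]] := left_right_kids (lt_dkid b bx).
have [lta ltb] := (ltn_eqF (lt_dkid a ax), ltn_eqF (lt_dkid b bx)).
have ab : a != b by apply: contraNneq lb => <-.
have a12 : a1 != a2 by apply: contraNneq la2 => <-.
have b12 : b1 != b2 by apply: contraNneq lb2 => <-.
have [da1 da2] := (dleaf _ _ ax a1a, dleaf _ _ ax a2a).
have [db1 db2] := (dleaf _ _ bx b1b, dleaf _ _ bx b2b).
have [[ar pa] [br pb]] := (kidsP ax, kidsP bx).
have [[a1r pa1] [a2r pa2]] := (kidsP a1a, kidsP a2a).
have [[b1r pb1] [b2r pb2]] := (kidsP b1b, kidsP b2b).
have xa1 : below x a1 := below_trans (below_kid ax) (below_kid a1a).
have Nb : ~~ below b a1 := not_below_sibling rt ax bx ab (below_kid a1a).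
have up y : below y a1 -> y != r -> tdist a1 (par y) =
    tdist a1 y + if odd (tdist a1 y) == left y then 2 else 1.
  by move=> ya yr; rewrite (tdist_up lamP rt ya yr) /next_time odd_edgeC left_edge.
have down y : ~~ below y a1 -> y != r -> tdist a1 y =
    tdist a1 (par y) + if odd (tdist a1 (par y)) == left y then 2 else 1.
  by move=> ya yr; rewrite (tdist_down lamP rt ya) /next_time left_edge.
have ta1 : tdist a1 a1 = 0 := tdist_refl lamP rt a1.
have ta : tdist a1 a = 1 by rewrite -pa1 up ?below_refl // ta1 la1.
have tx : tdist a1 x = 3 by rewrite -pa up ?(below_kid a1a) // ta la.
have ta2 : tdist a1 a2 = 2.
  by rewrite down ?(not_below_leaf da2) // pa2 ta (negPf la2).
have tb : tdist a1 b = 4 by rewrite down // pb tx (negPf lb).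
have Nb' c : c \in kids b -> ~~ below c a1.
  by move=> cb; apply: contra Nb; apply: below_trans (below_kid cb).
have tb1 : tdist a1 b1 = 5 by rewrite down ?Nb' // pb1 tb lb1.
have tb2 : tdist a1 b2 = 6 by rewrite down ?Nb' // pb2 tb (negPf lb2).
pose ys := [:: x; a; b; a1; a2; b1; b2].
have block y : below x y -> y \in ys.
  case/(below_cases ax bx ab) => [->||]; first by rewrite inE eqxx.
    case/(below_cases a1a a2a a12) => [->||]; first by rewrite !inE eqxx orbT.
      by move=> /(leaf_below rt n_gt0 fb da1)->; rewrite !inE eqxx !orbT.
    by move=> /(leaf_below rt n_gt0 fb da2)->; rewrite !inE eqxx !orbT.
  case/(below_cases b1b b2b b12) => [->||]; first by rewrite !inE eqxx !orbT.
    by move=> /(leaf_below rt n_gt0 fb db1)->; rewrite !inE eqxx !orbT.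
  by move=> /(leaf_below rt n_gt0 fb db2)->; rewrite !inE eqxx !orbT.
exists a1; first by rewrite inE da1 eqxx la1 pa1 la.
split=> // [y /block yB|y z /block yB /block zB tE].
  apply: (allP (_ : all (fun y => tdist a1 y <= (if d y == n.-1 then 6 else 4)) ys)) yB.
  rewrite /= tx ta tb ta1 ta2 tb1 tb2 da1 da2 db1 db2 lta ltb eqxx /=.
  by case: ifP.
(* Injectivity is checked by computation on all pairs of the seven vertices. *)
have /allP/(_ y yB)/allP/(_ z zB) : all (fun y => all (fun z =>
    (tdist a1 y == tdist a1 z) ==> (y == z)) ys) ys.
  by rewrite /= tx ta tb ta1 ta2 tb1 tb2 !eqxx.
by rewrite tE eqxx => /eqP.
Qed.

(** The grandparent map sends [R] into level [n - 3], and it is injective because no vertex has two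
    left children. *)
Lemma card_left_block : 2 < n -> #|R| <= 2 ^ (n - 3).
Proof.
move=> n_gt2; rewrite -(full_level rt n_gt0 fb (k := n - 3)); last by lia.
rewrite -(card_in_imset (f := par \o par) (D := mem R)); last first.
  move=> s s'; rewrite !inE => /and3P[/eqP ds ls lps] /and3P[/eqP ds' ls' lps'] /= e.
  have nr v : 0 < d v -> v != r by apply: contraTneq => ->; rewrite (depth_root rt).
  have sr : s != r by apply: nr; lia.
  have s'r : s' != r by apply: nr; lia.
  have [dE dE'] := (depth_par rt sr, depth_par rt s'r).
  have pr : par s != r by apply: nr; lia.
  have p'r : par s' != r by apply: nr; lia.
  apply: left_kid_inj (kids_par par sr) _ ls ls'.
  rewrite (left_kid_inj (kids_par par pr) _ lps lps') ?kids_par //.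
  by rewrite e kids_par.
apply/subset_leq_card/subsetP=> _ /imsetP[s + ->]; rewrite !inE => /and3P[/eqP ds _ _] /=.
have sr : s != r by apply/eqP => sr; rewrite sr (depth_root rt) in ds; lia.
have dE := depth_par rt sr.
have pr : par s != r by apply/eqP => pr; rewrite pr (depth_root rt) in dE; lia.
by have := depth_par rt pr; lia.
Qed.

(** The path leaves through [x], then meets [par y], then [y], which takes at least 2 time-steps,
    and afterwards at least 1 per level. *)
Lemma far_block s x y v :
  below x s -> d x = d y -> x != y -> below y v -> tdist s x + 2 + (d v - d y) <= tdist s v.
Proof.
move=> xs dxy xy yv.
have ys : ~~ below y s by apply: contra xy => ys; apply/eqP/(below_same_depth xs ys).
have yr : y != r by apply: contraNneq ys => ->; apply: below_root rt _.
have xp : ~~ below x (par y).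
  by apply/negP => /(below_depth rt); have := depth_par rt yr; lia.
have := tdist_leave lamP rt xs xp; have := tdist_down_lt lamP rt ys.
have := tdist_descend ys yv; lia.
Qed.

Lemma left_block_resolving : 2 < n -> temporal_resolving lam R.
Proof.
move=> n_gt2; have cov u : d u <= n - 3 -> exists2 s, s \in R & below u s.
  move=> du; have [|x ux dx] := @descendant_at u (n - 3); first by lia.
  have [s sR [xs _ _ _]] := left_block n_gt2 dx; exists s => //.
  exact: below_trans ux xs.
have high u v : d u <= n - 3 -> u <> v -> exists2 s, s \in R & tdist s u <> tdist s v.
  move=> du uv; have [uv'|] := boolP (below u v); last exact: leave_resolves (cov _ du).
  (* At depth [n - 3] both vertices lie in the block of [u]. Higher up, the child of [u] away from
     [v] still has a source below it. *)
  have [du'|du'] := eqVneq (d u) (n - 3).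
    have [s sR [_ _ _ inj]] := left_block n_gt2 du'; exists s => //.
    by move/(inj _ _ (below_refl par u) uv').
  have [|c cu cv] := below_toward rt uv'; first by apply/eqP => vu; apply: uv.
  have [c' c'u cc'] := full_other_kid rt n_gt0 fb cu.
  apply: (enter_resolves cu c'u cc' cv); apply: cov.
  by rewrite (depth_kid rt c'u); lia.
apply/(resolvingP lamP rt); split=> [|u v uv].
  by have [s sR _] := cov r ltac:(by rewrite (depth_root rt)); exists s.
have [du|du] := leqP (d u) (n - 3); first exact: high.
have [dv|dv] := leqP (d v) (n - 3).
  by have [s sR ns] := high v u dv (nesym uv); exists s => // e; apply: ns.
have [x xu dx] := ancestor_at (ltnW du); have [y yv dy] := ancestor_at (ltnW dv).
have [sx sxR [xs tx bndx inj]] := left_block n_gt2 dx.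
have [xy|xy] := eqVneq x y.
  by exists sx => //; rewrite -xy in yv; move/(inj _ _ xu yv).
have [sy syR [ys ty bndy _]] := left_block n_gt2 dy.
have dxy : d x = d y by rewrite dx dy.
have := far_block xs dxy xy yv; rewrite eq_sym in xy.
have := far_block ys (esym dxy) xy xu.
have := bndx u xu; have := bndy v yv; rewrite tx ty dx dy => b1 b2 f1 f2.
(* Different blocks. If [u] is not a leaf, [sx] reaches it by time 4, but [v] not before 3 + 2 + 1 =
   6. If [u] is a leaf, [sy] reaches [v] by time 6, but [u] not before 3 + 2 + 2 = 7. *)
have [du'|du'] := eqVneq (d u) n.-1; last first.
  exists sx => // e; move: b2 f2; rewrite (negPf du') e; lia.
exists sy => // e; move: b1 f1; rewrite du' e; case: ifP; lia.
Qed.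

Lemma temporal_dim_alternating : 2 < n -> temporal_dim lam = 2 ^ (n - 3).
Proof.
move=> n_gt2; apply/eqP; rewrite eqn_leq temporal_dim_lower // andbT.
apply: leq_trans (card_left_block n_gt2).
exact: (temporal_dim_le lamP rt (left_block_resolving n_gt2)).
Qed.

End Alternating.
End Bounds.

(** * Labelings with prescribed parities on the parent edges *)

Section EdgeLabeling.
Variables (G : sgraph) (r : G) (par : G -> G) (d : G -> nat) (f : pred G).
Hypothesis rt : rooted_tree r par d.

(** A labeling takes an unordered pair, so the child endpoint is recovered existentially;
    [parent_edge_inj] makes it unique. *)
Definition edge_labeling : labeling G := fun e t =>
  exists v, [/\ v != r, e = [set v; par v], 0 < t & odd t = f v].

(** Otherwise each of [v] and [w] would be the parent of the other, against their depths. *)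
Lemma parent_edge_inj v w :
  v != r -> w != r -> [set v; par v] = [set w; par w] -> v = w.
Proof.
move=> vr wr e; have := set21 v (par v); rewrite e => /set2P[//|vw].
have := set21 w (par w); rewrite -e => /set2P[//|wv].
have := depth_par rt vr; have := depth_par rt wr; rewrite -vw -wv; lia.
Qed.

Lemma edge_labelingE v t :
  v != r -> edge_labeling [set v; par v] t <-> 0 < t /\ odd t = f v.
Proof.
move=> vr; split=> [[w [wr /(parent_edge_inj vr wr) ->]]//|[t0 tf]].
by exists v.
Qed.

Lemma edge_labeling_periodic : periodic1_labeling 2 edge_labeling.
Proof.
have per v : v != r -> exists i, 1 <= i <= 2 /\
    (forall t, edge_labeling [set v; par v] t <-> exists k, t = i + k * 2).
  move=> vr; exists (if f v then 1 else 2); split; first by case: (f v).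
  move=> t; rewrite edge_labelingE //; split=> [[t0 tf]|[k ->]].
    by exists (t.-1 %/ 2); move: tf; case: (f v); lia.
  by case: (f v); split; lia.
move=> u v; rewrite (adj_kids rt) => /orP[]/kidsP[/per + <-] //.
by rewrite setUC.
Qed.

Lemma edge_labeling_odd v : v != r -> odd_edge edge_labeling (par v) v = f v.
Proof.
move=> vr; rewrite odd_edgeC; apply/asboolP/idP => [/(edge_labelingE _ vr)[_ <-]//|fv].
by apply/(edge_labelingE _ vr); rewrite fv.
Qed.

End EdgeLabeling.

(** * The binary heap as a concrete complete binary tree *)

Section Heap.
Variable n : nat.
Hypothesis n_gt0 : 0 < n.

Lemma heap_size_gt0 : 0 < 2 ^ n - 1.
Proof. by rewrite subn_gt0 -[X in X < _](expn0 2) ltn_exp2l. Qed.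

Definition heap_root : 'I_(2 ^ n - 1) := Ordinal heap_size_gt0.

Lemma heap_parent_lt (i : 'I_(2 ^ n - 1)) : i.-1./2 < 2 ^ n - 1.
Proof. by have := ltn_ord i; lia. Qed.

(** Indices start at 0: the children of [i] are [2 i + 1] and [2 i + 2], and truncated predecessor
    makes 0 its own parent. *)
Definition heap_parent i : 'I_(2 ^ n - 1) := Ordinal (heap_parent_lt i).

(** Level [k] consists of the indices [i] with [2 ^ k <= i + 1 < 2 ^ (k + 1)]. *)
Definition heap_depth (i : 'I_(2 ^ n - 1)) := trunc_log 2 i.+1.

Definition heap_adj : rel 'I_(2 ^ n - 1) := fun i j =>
  ((i != heap_root) && (heap_parent i == j)) ||
  ((j != heap_root) && (heap_parent j == i)).

Lemma heap_adj_sym : symmetric heap_adj.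
Proof. by move=> i j; rewrite /heap_adj orbC. Qed.

Lemma heap_adj_irr : irreflexive heap_adj.
Proof.
by move=> i; rewrite /heap_adj orbb -!val_eqE /=; apply/negP => /andP[]; lia.
Qed.

Definition heap : sgraph := SGraph heap_adj_sym heap_adj_irr.

Lemma heap_rooted : @rooted_tree heap heap_root heap_parent heap_depth.
Proof.
split=> [|||u v]; rewrite /heap_depth.
- exact: val_inj.
- by rewrite /= trunc_log1.
- move=> v; rewrite -val_eqE /= => v0; rewrite trunc_log2S; last by lia.
  by congr (trunc_log 2 _).+1; lia.
by rewrite !inE.
Qed.

Lemma heap_full : @full_binary heap heap_root heap_parent heap_depth n.
Proof.
have pow_n : 2 ^ n = 2 * 2 ^ n.-1 by rewrite -expnS prednK.
split=> v.
  rewrite /heap_depth -(@ltn_exp2l 2) //.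
  apply: leq_ltn_trans (trunc_logP (p := 2) (n := v.+1) _ _) _ => //.
  by have := ltn_ord v; lia.
move=> dv; have lt_v : v.+1 < 2 ^ n.-1.
  by apply: leq_trans (trunc_log_ltn v.+1 (p := 2) _) _ => //; rewrite leq_exp2l.
have lt1 : v.*2.+1 < 2 ^ n - 1 by lia.
have lt2 : v.*2.+2 < 2 ^ n - 1 by lia.
apply/eqP/cards2P; exists (Ordinal lt1 : heap), (Ordinal lt2 : heap); split.
  by rewrite -val_eqE /=; lia.
apply/setP=> c; rewrite !inE -!val_eqE /=; lia.
Qed.

Lemma heap_cbt : complete_binary_tree heap n.
Proof. exact: (full_cbt heap_rooted n_gt0 heap_full (card_ord _)). Qed.

(** Of the two children exactly one has odd index, so the parity of the index serves as an
    alternating labeling. *)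
Lemma heap_siblings (v a b : heap) :
  a \in kids (heap_root : heap) heap_parent v ->
  b \in kids (heap_root : heap) heap_parent v -> a != b ->
  odd (val a) != odd (val b).
Proof.
by rewrite !inE -!val_eqE /= => /andP[a0 /eqP av] /andP[b0 /eqP bv]; lia.
Qed.

End Heap.

Lemma constant_periodic (G : sgraph) : periodic1_labeling 2 (fun (_ : {set G}) t => odd t).
Proof.
move=> u v _; exists 1; split=> // t; split=> [ot|[k ->]]; last by lia.
by exists (t %/ 2); lia.
Qed.

Theorem theorem17 (n : nat) (hn : 2 <= n) :
  (forall (T : sgraph) (lam : labeling T),
     complete_binary_tree T n -> periodic1_labeling 2 lam ->
     ((2%:Q ^ (n%:Z - 3) <= (temporal_dim lam)%:R)%R /\
      ((temporal_dim lam)%:R <= 2%:Q ^ (n%:Z - 2))%R)) /\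
  (3 <= n ->
   exists (T : sgraph) (lam : labeling T),
     [/\ complete_binary_tree T n, periodic1_labeling 2 lam
       & temporal_dim lam = 2 ^ (n - 3)]) /\
  (exists (T : sgraph) (lam : labeling T),
     [/\ complete_binary_tree T n, periodic1_labeling 2 lam
       & temporal_dim lam = 2 ^ (n - 2)]).
Proof.
have n_gt0 := ltnW hn; have rtH := heap_rooted n_gt0; have fbH := heap_full n_gt0.
split=> [T lam cbtT lamP|]; last split=> [n_gt2|].
- have [r [par [d [rt fb]]]] := cbt_rooted n_gt0 cbtT.
  have powE k : k <= n -> (2%:Q ^ (n%:Z - k%:Z) = (2 ^ (n - k))%:R)%R.
    by move=> kn; rewrite subzn // GRing.natrX.
  split; last first.
    by rewrite (powE 2) // Num.Theory.ler_nat (temporal_dim_upper lamP rt hn fb).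
  have [n_gt2|n_le2] := ltnP 2 n.
    by rewrite (powE 3) // Num.Theory.ler_nat (temporal_dim_lower lamP rt hn fb).
  (* For [n = 2] the lower bound is the rational 1/2, and a resolving set is nonempty. *)
  have -> : n = 2 by lia.
  have dim_ge1 : (1 <= (temporal_dim lam)%:R :> rat)%R.
    by rewrite Num.Theory.ler1n (temporal_dim_gt0 lamP rt).
  exact: Order.POrderTheory.le_trans dim_ge1.
- pose left := fun v : heap n_gt0 => odd (val v).
  have lamP := edge_labeling_periodic left rtH.
  exists (heap n_gt0), (edge_labeling (heap_root n_gt0 : heap n_gt0) (heap_parent n_gt0) left).
  split=> //; first exact: heap_cbt.
  apply: (temporal_dim_alternating lamP rtH hn fbH (left := left)) => //.
    exact: edge_labeling_odd rtH.
  exact: heap_siblings.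
exists (heap n_gt0), (fun _ t => odd t); split; first exact: heap_cbt.
  exact: constant_periodic.
apply: (temporal_dim_constant (@constant_periodic _) rtH hn fbH) => u v.
exact/asboolP.
Qed.
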